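(* Let $X$ be a Banach space (over $\mathbb K\in\{\mathbb R,\mathbb C\}$) with a Schauder basis. If the basis is shrinking or boundedly complete, then every bounded convex subset of $X$ has a countable $\pi$-base for its relative weak topology. In particular, $(B_X,w)$, the closed unit ball with its relative weak topology, has a countable $\pi$-base.
   Context: Let $(e_j)_{j=1}^\infty$ be a Schauder basis of $X$. It is shrinking if the associated biorthogonal sequence $(e_j^* )_{j=1}^\infty$ is a Schauder basis of $X^*$. It is boundedly complete if $\sum_{j=1}^\infty a_je_j$ converges whenever the scalar sequence $(a_j)_{j=1}^\infty$ satisfies $\sup_{n\in\mathbb N}\left\|\sum_{j=1}^n a_je_j\right\|<\infty$. A $\pi$-base for a topological space $(T,\tau)$ is a family $\mathcal U$ of nonempty open subsets of $T$ such that every nonempty open subset of $T$ contains some member of $\mathcal U$; the space has a countable $\pi$-base if $\mathcal U$ can be chosen countable. *)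

(* Defs.v *)
(* Normed spaces are those of MathComp-Analysis: a normedModType over a
   numFieldType K has a K-valued norm, also for K = R[i], where 0 <= z means
   that z is a nonnegative real. *)
From HB Require Import structures.
From mathcomp Require Import all_boot all_order all_algebra.
From mathcomp Require Import all_classical all_reals all_analysis.
From mathcomp Require Import complex.

Set Implicit Arguments.
Unset Strict Implicit.
Unset Printing Implicit Defensive.

Import Order.TTheory GRing.Theory Num.Theory.
Import numFieldNormedType.Exports.

Local Open Scope classical_set_scope.
Local Open Scope ring_scope.

Variant scalar_kind := RealScalars | ComplexScalars.

Definition scalar_field (R : realType) (k : scalar_kind) : numFieldType :=
  match k with
  | RealScalars => R
  | ComplexScalars => R[i]
  end.

Lemma scalar_supremums (R : realType) (k : scalar_kind)
    (A : set (scalar_field R k)) :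
  A !=set0 -> A `<=` [set x | 0 <= x] -> has_ubound A -> supremums A !=set0.
Proof.
case: k A => /= A A0 Age0 [M AM].
  exists (sup A); split => [x Ax|x]; last exact: ge_sup.
  by apply: sup_upper_bound => //; split=> //; exists M.
have realE (z : R[i]) : 0 <= z -> z = (complex.Re z)%:C%C.
  by case: z => a b; rewrite lecE /= => /andP[/eqP -> _].
have [z Az] := A0.
have hsB : has_sup (@complex.Re R @` A).
  split; first by exists (complex.Re z), z.
  exists (complex.Re M) => _ [y Ay <-].
  by have := AM _ Ay; rewrite lecE => /andP[].
exists (sup (@complex.Re R @` A))%:C%C; split => [x Ax|x Bx].
  rewrite (realE x (Age0 _ Ax)) lecR.
  by apply: sup_upper_bound => //; exists x.
rewrite (realE x) ?lecR; last exact: le_trans (Age0 _ Az) (Bx _ Az).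
apply: ge_sup; first by exists (complex.Re z), z.
by move=> _ [y Ay <-]; have := Bx _ Ay; rewrite lecE => /andP[].
Qed.

Section Dual.
Context (K : numFieldType) (X : normedModType K).

Definition dual_pred : {pred X -> K^o} :=
  fun f => `[< linear f /\ continuous f >].

Lemma dual_pred_submod : submod_closed dual_pred.
Proof.
split.
  apply/asboolP; split=> [a x y|x]; last exact: cst_continuous.
  by rewrite -[RHS]/(a *: (0 : K^o) + 0) scaler0 addr0.
move=> a f g /asboolP[lf cf] /asboolP[lg cg]; apply/asboolP; split.
  move=> b x y; rewrite !fctE lf lg !scalerDr !scalerA (mulrC a b) -!addrA.
  by congr (_ + _); rewrite addrCA.
move=> x; apply: cvgD; last exact: cg.
by apply: cvgZr; exact: cf.
Qed.

HB.instance Definition _ :=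
  GRing.isSubmodClosed.Build K (X -> K^o) dual_pred dual_pred_submod.

Record dual : Type := Dual { dual_fun :> X -> K^o; _ : dual_fun \in dual_pred }.

HB.instance Definition _ := [isSub for dual_fun].
HB.instance Definition _ := [Choice of dual by <:].
HB.instance Definition _ := [SubChoice_isSubLmodule of dual by <:].

End Dual.

Section DualTheory.
Context (K : numFieldType) (X : normedModType K).
Implicit Types f g : dual X.

Lemma dual_linear f : linear (f : X -> K^o).
Proof. by case: f => f /= /asboolP[]. Qed.

Lemma dual_continuous f : continuous (f : X -> K^o).
Proof. by case: f => f /= /asboolP[]. Qed.

Lemma dualDE f g x : (f + g) x = f x + g x. Proof. by []. Qed.
Lemma dualZE a f x : (a *: f) x = a * f x. Proof. by []. Qed.

Lemma dual_at0 f : f 0 = 0.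
Proof.
have := dual_linear f 1 0 0; rewrite !scale1r addr0.
by move=> /eqP; rewrite -subr_eq subrr => /eqP <-.
Qed.

Lemma dual_scale f a x : f (a *: x) = a * f x.
Proof. by have := dual_linear f a x 0; rewrite !addr0 dual_at0 addr0. Qed.

(* The least upper bound in the partially ordered field K; for K = R or C it
   exists by scalar_supremums and dual_image_bounded. *)
Definition dual_norm f : K :=
  supremum 0 [set `|f x| | x in [set x : X | `|x| <= 1]].

Lemma dual_image_bounded f :
  has_ubound [set `|f x| | x in [set x : X | `|x| <= 1]].
Proof.
pose g : {linear X -> K^o} :=
  HB.pack (f : X -> K^o) (GRing.isLinear.Build _ _ _ _ _ (dual_linear f)).
have /linear_bounded_continuous/linear_boundedP : continuous g.
  exact: dual_continuous.
move=> /pinfty_ex_gt0[r r0 fr]; exists r => _ [x /= x1 <-].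
by apply: le_trans (fr x) _; rewrite ler_piMr // ltW.
Qed.

End DualTheory.

Section DualNormed.
Context (R : realType) (k : scalar_kind) (X : normedModType (scalar_field R k)).
Implicit Types f g : dual X.

Let dual_norm_lub f :
  supremums [set `|f x| | x in [set x : X | `|x| <= 1]] (dual_norm f).
Proof.
set A := [set _ | _ in _].
have A0 : A !=set0 by exists `|f 0|, 0 => //=; rewrite normr0.
rewrite /dual_norm -/A /supremum; case: ifPn => [/eqP A_eq0|_].
  by case: A0 => x; rewrite A_eq0.
have [y Ay] : supremums A !=set0.
  apply: scalar_supremums => //; last exact: dual_image_bounded.
  by move=> _ [x _ <-] /=.
exact: (xgetI 0 Ay).
Qed.

Let dual_norm_ub f x : `|x| <= 1 -> `|f x| <= dual_norm f.
Proof. by move=> x1; apply: (dual_norm_lub f).1; exists x. Qed.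

Let dual_norm_le f c :
  (forall x, `|x| <= 1 -> `|f x| <= c) -> dual_norm f <= c.
Proof. by move=> fc; apply: (dual_norm_lub f).2 => _ [x x1 <-]; exact: fc. Qed.

Let dual_norm_ge0 f : 0 <= dual_norm f.
Proof.
by apply: le_trans (normr_ge0 (f 0)) (dual_norm_ub _ _); rewrite normr0.
Qed.

Let dual_normD f g : dual_norm (f + g) <= dual_norm f + dual_norm g.
Proof.
apply: dual_norm_le => x x1; rewrite dualDE.
by apply: le_trans (ler_normD _ _) (lerD _ _); exact: dual_norm_ub.
Qed.

Let dual_normZ_le a f : dual_norm (a *: f) <= `|a| * dual_norm f.
Proof.
apply: dual_norm_le => x x1; rewrite dualZE normrM ler_wpM2l //.
exact: dual_norm_ub.
Qed.

Let dual_normZ a f : dual_norm (a *: f) = `|a| * dual_norm f.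
Proof.
apply/le_anti/andP; split; first exact: dual_normZ_le.
have [->|a0] := eqVneq a 0; first by rewrite normr0 mul0r.
rewrite -ler_pdivlMl ?normr_gt0 // -normfV.
by rewrite -[in leLHS](scalerK a0 f); exact: dual_normZ_le.
Qed.

Let dual_norm0_eq0 f : dual_norm f = 0 -> f = 0.
Proof.
move=> f0; apply/val_inj/funext => x /=.
have [->|x0] := eqVneq x 0; first by rewrite dual_at0.
have nx0 : `|x| != 0 by rewrite normr_eq0.
have : `|f (`|x|^-1 *: x)| <= 0.
  by rewrite -f0; apply: dual_norm_ub; rewrite normrZ normfV normr_id mulVf.
by rewrite normr_le0 dual_scale mulf_eq0 invr_eq0 (negPf nx0) => /eqP.
Qed.

HB.instance Definition _ := @Lmodule_isNormed.Build (scalar_field R k) (dual X)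
  (@dual_norm _ X) dual_normD dual_normZ dual_norm0_eq0.

End DualNormed.

Definition weak (K : numFieldType) (X : normedModType K) : Type := X.

HB.instance Definition _ (K : numFieldType) (X : normedModType K) :=
  Choice.on (weak X).

HB.instance Definition _ (K : numFieldType) (X : normedModType K) :=
  Topological.copy (weak X)
    (sup_topology (fun f : dual X =>
      Topological.on (initial_topology (f : X -> K^o)))).

Section Bases.
Context (K : numFieldType) (X : normedModType K).

Definition schauder_basis (e : nat -> X) :=
  forall x : X, exists! a : nat -> K,
    series (fun j => a j *: e j) @ \oo --> x.

Definition boundedly_complete (e : nat -> X) :=
  forall a : nat -> K, bounded_fun (series (fun j => a j *: e j)) ->
    cvgn (series (fun j => a j *: e j)).

Definition biorthogonal (e : nat -> X) (es : nat -> dual X) :=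
  forall i j, es i (e j) = (i == j)%:R.

End Bases.

(* The associated biorthogonal sequence is determined by biorthogonality: for a
   Schauder basis e the coordinate functionals have this property, and they are
   the only ones in the dual because the span of e is dense. *)
Definition shrinking (R : realType) (k : scalar_kind)
    (X : normedModType (scalar_field R k)) (e : nat -> X) :=
  exists2 es : nat -> dual X, biorthogonal e es & schauder_basis es.

Definition pi_base (T : topologicalType) (U : set (set T)) :=
  (forall A, U A -> open A /\ A !=set0) /\
  (forall A, open A -> A !=set0 -> exists2 B, U B & B `<=` A).

Definition has_countable_pi_base (T : topologicalType) :=
  exists2 U : set (set T), countable U & pi_base U.

(* Main.v *)
Require Import Defs.
From mathcomp Require Import all_boot all_order all_algebra.
From mathcomp Require Import all_classical all_reals all_analysis.
From mathcomp Require Import complex finmap ring lra.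
Import Order.TTheory GRing.Theory Num.Theory.
Import numFieldNormedType.Exports.
Local Open Scope classical_set_scope.
Local Open Scope ring_scope.

(** If the basis is shrinking, every functional is a norm limit of combinations
    of the coordinate functionals, so on a bounded set [A] the sets cut out by
    finitely many coordinates and rational data already form a countable base.

    If the basis is boundedly complete, every nonempty weakly open subset [V] of
    a bounded set contains nonempty weakly open subsets of arbitrarily small
    diameter. Otherwise some [r > 0] and some [a_0, a_1, ...] in [V] satisfy
    [r <= |a_(i+1) - a_i|], while the coordinates of [a_(i+1) - a_i] are
    negligible on an initial segment outside of which [a_i] itself is
    negligible. The limits of the coordinates of [a_i] have bounded partial
    sums, hence define a vector [x] with [|a_i - x|] eventually much smaller
    than [r], a contradiction. The weak interiors of the balls centred at
    rational combinations of the basis are then a countable pi-base, because a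
    small weakly open set lies in such a ball, and the ball in [V]. *)

(** * Real-valued norms over both scalar fields *)

Lemma ltr_Re_normc (R : realType) (x y e : R) :
  `|x| < e / 2 -> `|y| < e / 2 -> complex.Re `|(x +i* y)%C : R[i]| < e.
Proof.
move=> xe ye; have e0 : 0 < e.
  by rewrite -(@pmulr_lgt0 _ 2^-1)// (le_lt_trans _ xe).
rewrite normc_def /= -(ger0_norm (ltW e0)) -sqrtr_sqr ltr_sqrt ?exprn_gt0//.
by move: xe ye; rewrite !ltr_norml => /andP[? ?] /andP[? ?]; nra.
Qed.

Section RealNorm.
Context {R : realType} {k : scalar_kind}.
Local Notation K := (scalar_field R k).

(* Library norms take values in the scalar field, where over R[i] the order is
   partial; [real_part] moves them to R, where the order is total. *)
Definition real_part : K -> R :=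
  match k return scalar_field R k -> R with
  | RealScalars => id
  | ComplexScalars => @complex.Re R
  end.

Lemma real_partD x y : real_part (x + y) = real_part x + real_part y.
Proof. by rewrite /real_part; case: k x y => //= -[a b] [c d]. Qed.

Lemma ler_real_part x y : x <= y -> real_part x <= real_part y.
Proof.
by rewrite /real_part; case: k x y => //= x y; rewrite lecE => /andP[].
Qed.

Lemma ltr_real_part x y : 0 <= x -> 0 <= y ->
  (real_part x < real_part y) = (x < y).
Proof.
rewrite /real_part; case: k x y => //= -[a b] [c d].
by rewrite !ltcE !lecE /= => /andP[/eqP -> _] /andP[/eqP -> _]; rewrite eqxx.
Qed.

Lemma real_part_le x y : 0 <= x -> 0 <= y ->
  (real_part x <= real_part y) = (x <= y).
Proof.
rewrite /real_part; case: k x y => //= -[a b] [c d].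
by rewrite !lecE /= => /andP[/eqP -> _] /andP[/eqP -> _]; rewrite eqxx.
Qed.

Lemma real_partM x y : 0 <= x -> real_part (x * y) = real_part x * real_part y.
Proof.
rewrite /real_part; case: k x y => //= -[a b] [c d].
by rewrite lecE /= => /andP[/eqP -> _]; rewrite mul0r subr0.
Qed.

Lemma real_part0 : real_part 0 = 0.
Proof. by rewrite /real_part; case: k. Qed.

Lemma real_part1 : real_part 1 = 1.
Proof. by rewrite /real_part; case: k. Qed.

Lemma real_part_surj (r : R) : 0 <= r -> exists2 z, 0 <= z & real_part z = r.
Proof.
rewrite /real_part; case: k => /= r0; first by exists r.
by exists r%:C%C => //; rewrite ler0c.
Qed.

Definition nm (V : normedZmodType K) (x : V) : R := real_part `|x|.
Arguments nm {V}.

Section NormTheory.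
Context {V : normedZmodType K}.
Implicit Types x y : V.

Lemma nm_ge0 x : 0 <= nm x.
Proof. by rewrite -real_part0 ler_real_part. Qed.

Lemma nm0 : nm (0 : V) = 0.
Proof. by rewrite /nm normr0 real_part0. Qed.

Lemma nm_gt0 x : (0 < nm x) = (x != 0).
Proof. by rewrite -real_part0 ltr_real_part ?normr_gt0. Qed.

Lemma nmN x : nm (- x) = nm x.
Proof. by rewrite /nm normrN. Qed.

Lemma nmB x y : nm (x - y) = nm (y - x).
Proof. by rewrite /nm distrC. Qed.

Lemma ler_nmD x y : nm (x + y) <= nm x + nm y.
Proof. by rewrite -real_partD ler_real_part// ler_normD. Qed.

Lemma ler_nmD_dist y x z : nm (x - z) <= nm (x - y) + nm (y - z).
Proof. by rewrite (le_trans _ (ler_nmD _ _))// addrA subrK. Qed.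

Lemma ler_nm_sum (I : Type) (r : seq I) (F : I -> V) :
  nm (\sum_(i <- r) F i) <= \sum_(i <- r) nm (F i).
Proof.
elim: r => [|i r IH]; first by rewrite !big_nil nm0.
by rewrite !big_cons (le_trans (ler_nmD _ _))// lerD2l.
Qed.

End NormTheory.

Lemma nmZ (V : normedModType K) (a : K) (x : V) : nm (a *: x) = nm a * nm x.
Proof. by rewrite /nm normrZ real_partM. Qed.

Lemma nmM (a b : K) : nm (a * b) = nm a * nm b.
Proof. by rewrite /nm normrM real_partM. Qed.

Lemma nm_surj (r : R) : 0 <= r -> exists z : K, nm z = r.
Proof.
by move=> /real_part_surj[z z0 <-]; exists z; rewrite /nm ger0_norm.
Qed.

Lemma nm_lt (V : normedZmodType K) (x : V) (e : K) : 0 < e ->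
  (`|x| < e) = (nm x < real_part e).
Proof. by move=> e0; rewrite ltr_real_part// ltW. Qed.

Lemma real_part_gt0 (e : K) : 0 < e -> 0 < real_part e.
Proof. by move=> e0; rewrite -real_part0 ltr_real_part// ltW. Qed.

Lemma nm_cvgP (V : normedModType K) (u : nat -> V) (l : V) :
  u @ \oo --> l <-> forall e : R, 0 < e ->
    exists N, forall n, (N <= n)%N -> nm (u n - l) < e.
Proof.
split=> [/cvgrPdist_lt ul e e0|ul].
  have [z z0 ze] := real_part_surj _ (ltW e0).
  have zgt0 : 0 < z.
    by rewrite -ltr_real_part// real_part0 ze.
  have [N _ NP] := ul z zgt0.
  exists N => n Nn; have /= := NP n Nn.
  by rewrite (nm_lt _ _ _ zgt0) ze nmB.
apply/cvgrPdist_lt => e e0.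
have [N NP] := ul _ (real_part_gt0 _ e0).
exists N => // n /= Nn.
by rewrite nm_lt// nmB NP.
Qed.

Lemma nm_complete (V : completeNormedModType K) (u : nat -> V) :
  (forall e : R, 0 < e ->
    exists N, forall n, (N <= n)%N -> nm (u n - u N) < e) ->
  exists l : V, u @ \oo --> l.
Proof.
move=> uC; suff uc : cauchy (u @ \oo).
  by apply/cvg_ex; exact: cauchy_cvg.
apply/cauchy_exP => e e0; have [N NP] := uC _ (real_part_gt0 _ e0).
exists (u N), N => // n /= Nn.
by rewrite -ball_normE /ball_/= nm_lt// nmB NP.
Qed.

(** Completeness has to be proved by cases, because [scalar_field R k] is only typed as a
    [numFieldType]. Over the complex numbers the real and imaginary parts are dominated by the
    modulus, hence Cauchy in [R]. *)
Lemma nm_scalar_complete (u : nat -> K) :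
  (forall e : R, 0 < e ->
    exists N, forall n, (N <= n)%N -> nm (u n - u N) < e) ->
  exists l : K, forall e : R, 0 < e ->
    exists N, forall n, (N <= n)%N -> nm (u n - l) < e.
Proof.
rewrite /nm/real_part.
have Rcompl (v : nat -> R) : (forall e : R, 0 < e ->
    exists N, forall n, (N <= n)%N -> `|v n - v N| < e) ->
  exists l : R, forall e : R, 0 < e ->
    exists N, forall n, (N <= n)%N -> `|v n - l| < e.
  move=> vC; suff vc : cauchy (v @ \oo).
    exists (lim (v @ \oo)) => e e0.
    have vl : cvg (v @ \oo) by exact: cauchy_cvg.
    have /cvgrPdist_lt/(_ e e0)[N _ NP] := vl.
    by exists N => n Nn; rewrite distrC; exact: (NP n Nn).
  apply/cauchy_exP => e e0; have [N NP] := vC _ e0.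
  by exists (v N), N => // n /= Nn; rewrite -ball_normE /ball_/= distrC NP.
case: k u => //= u uC.
have ReIm (z : R[i]) : `|complex.Re z| <= complex.Re `|z| /\
    `|complex.Im z| <= complex.Re `|z|.
  rewrite normc_def /= -!sqrtr_sqr; split; apply: ler_wsqrtr.
    by rewrite lerDl sqr_ge0.
  by rewrite lerDr sqr_ge0.
have [a ua] : exists l : R, forall e : R, 0 < e ->
    exists N, forall n, (N <= n)%N -> `|complex.Re (u n) - l| < e.
  apply: Rcompl => e e0; have [N NP] := uC e e0.
  exists N => n /NP; apply: le_lt_trans.
  by have [+ _] := ReIm (u n - u N); case: (u n) (u N) => ? ? [].
have [b ub] : exists l : R, forall e : R, 0 < e ->
    exists N, forall n, (N <= n)%N -> `|complex.Im (u n) - l| < e.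
  apply: Rcompl => e e0; have [N NP] := uC e e0.
  exists N => n /NP; apply: le_lt_trans.
  by have [_ +] := ReIm (u n - u N); case: (u n) (u N) => ? ? [].
exists (a +i* b)%C => e e0.
have e2 : 0 < e / 2 by rewrite divr_gt0.
have [N NP] := ua _ e2; have [M MP] := ub _ e2.
exists (maxn N M) => n; rewrite geq_max => /andP[/NP aN /MP bM].
rewrite (_ : u n - _ =
  ((complex.Re (u n) - a) +i* (complex.Im (u n) - b))%C); last by case: (u n).
exact: ltr_Re_normc.
Qed.

(** The witnesses are the rationals, or the complex numbers with rational parts, enumerated by
    [unpickle]; codes that decode to nothing are sent to 0. *)
Lemma scalar_dense : exists q : nat -> K, forall (z : K) (e : R), 0 < e ->
  exists n, nm (z - q n) < e.
Proof.
rewrite /nm/real_part.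
pose p n : rat := odflt 0 (choice.unpickle n).
have pdense (x e : R) : 0 < e -> exists n, `|x - ratr (p n)| < e.
  move=> e0; have [|r] := @rat_in_itvoo R (x - e) (x + e); first by lra.
  rewrite in_itv/= => /andP[r1 r2]; exists (choice.pickle r).
  by rewrite /p choice.pickleK /= ltr_norml; lra.
case: k => /=; first by exists (fun n => ratr (p n)).
pose pp n : nat * nat := odflt (0%N, 0%N) (choice.unpickle n).
exists (fun n => (ratr (p (pp n).1) +i* ratr (p (pp n).2))%C) => -[a b] e e0.
have e2 : 0 < e / 2 by rewrite divr_gt0.
have [n na] := pdense a _ e2; have [m mb] := pdense b _ e2.
exists (choice.pickle (n, m)); rewrite /pp choice.pickleK /=.
exact: ltr_Re_normc.
Qed.

End RealNorm.
Arguments nm {R k V}.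

(** * Weak neighbourhoods *)

Section WeakNbhd.
Context {R : realType} {k : scalar_kind}.
Local Notation K := (scalar_field R k).
Context {X : normedModType K}.
Implicit Types (A B : set X) (fs gs : seq (dual X)).

Lemma dualB (f : dual X) x y : f (x - y) = f x - f y.
Proof.
by rewrite -scaleN1r addrC dual_linear scaleN1r addrC.
Qed.

(** The trace on [A] is built in, so that relative weak openness can be handled on plain subsets of
    [X] instead of on the subtype. *)
Definition weak_nbhd A (a : X) fs (r : R) : set X :=
  [set y | A y /\ forall f, f \in fs -> nm (f y - f a) < r].

Lemma weak_nbhd_catl A a fs gs r s : r <= s ->
  weak_nbhd A a (fs ++ gs) r `<=` weak_nbhd A a fs s.
Proof.
move=> rs y [Ay yfg]; split=> // f ffs; apply: lt_le_trans rs.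
by apply: yfg; rewrite mem_cat ffs.
Qed.

Lemma weak_nbhd_catr A a fs gs r s : r <= s ->
  weak_nbhd A a (fs ++ gs) r `<=` weak_nbhd A a gs s.
Proof.
move=> rs y [Ay yfg]; split=> // f ffs; apply: lt_le_trans rs.
by apply: yfg; rewrite mem_cat ffs orbT.
Qed.

Definition weak_open A B := forall a, B a ->
  exists fs, exists2 r, 0 < r & weak_nbhd A a fs r `<=` B.

Lemma weak_open_setI A B C :
  weak_open A B -> weak_open A C -> weak_open A (B `&` C).
Proof.
move=> oB oC a [/oB[fs [r r0 fsB]] /oC[gs [s s0 gsC]]].
exists (fs ++ gs), (Num.min r s); first by rewrite lt_min r0.
move=> y yfg; split.
  by apply: fsB; apply: weak_nbhd_catl yfg; rewrite ge_min lexx.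
by apply: gsC; apply: weak_nbhd_catr yfg; rewrite ge_min lexx orbT.
Qed.

(** Finite intersections reduce this to a single functional, where the triangle inequality leaves
    the radius [r - nm (f b - f a)] around [b]. *)
Lemma weak_open_nbhd A a fs r : weak_open A (weak_nbhd A a fs r).
Proof.
elim: fs => [|f fs IH].
  by move=> b [Ab _]; exists [::], 1 => // y [Ay _].
have -> : weak_nbhd A a (f :: fs) r =
    weak_nbhd A a [:: f] r `&` weak_nbhd A a fs r.
  apply/seteqP; split=> y.
    by move=> [Ay yf]; split; split=> // g gfs; apply: yf;
      rewrite inE; move: gfs; rewrite ?inE => ->; rewrite ?orbT.
  move=> [[Ay yf] [_ yfs]]; split=> // g; rewrite inE => /orP[gf|]; last exact: yfs.
  by apply: yf; rewrite inE.
apply: weak_open_setI => // b [Ab bf].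
have fb : nm (f b - f a) < r by apply: bf; rewrite inE.
exists [:: f], (r - nm (f b - f a)); first by rewrite subr_gt0.
move=> y [Ay yf]; split=> // g; rewrite inE => /eqP ->.
have := yf f; rewrite inE => /(_ (eqxx _)).
by have := ler_nmD_dist (f b) (f y) (f a); lra.
Qed.

(** An open set of the sup topology is a union of finite intersections of preimages of open scalar
    sets, and each such preimage contains a one-functional neighbourhood. With [weak_nbhd_open] this
    links the topology to [weak_nbhd]. *)
Lemma open_weak_nbhd (O : set (weak X)) (a : X) : open O -> O a ->
  exists fs, exists2 r : R, 0 < r & weak_nbhd setT a fs r `<=` O.
Proof.
move=> [D sD <-] [C DC Ca].
have [E sE EC] := sD _ DC.
suff [fs [r r0 fsC]] : exists fs, exists2 r : R, 0 < r &
    weak_nbhd setT a fs r `<=` \bigcap_(i in [set` E]) id i.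
  by exists fs, r => // y /fsC; rewrite EC; exists C.
have Ea B : B \in E -> B a.
  by move=> BE; move: Ca; rewrite -EC; apply.
move=> {D C DC sD Ca EC}; rewrite bigcap_fset.
have {}sE (B : set (weak X)) : B \in E -> exists fs, exists2 r : R, 0 < r &
    weak_nbhd setT a fs r `<=` B.
  move=> BE; have Ba := Ea _ BE.
  have /set_mem[f _ [U oU fU]] := sE _ BE.
  have /nbhs_ballP[e /= e0 fe] : nbhs (f a) U.
    by apply: open_nbhs_nbhs; split=> //; move: Ba; rewrite -fU.
  exists [:: f], (real_part e); first exact: real_part_gt0.
  move=> y [_ yf]; rewrite -fU /=; apply: fe.
  by rewrite -ball_normE /ball_/= nm_lt// nmB yf// inE.
have {Ea}: {subset enum_fset E <= E} by [].
elim: (enum_fset E) => [_|B s IH sE'].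
  by exists [::], 1 => //; rewrite big_nil.
have [|fs [r r0 fsC]] := IH; first by move=> C Cs; apply: sE'; rewrite inE Cs orbT.
have [|gs [t t0 gsB]] := sE B; first by apply: sE'; rewrite inE eqxx.
exists (fs ++ gs), (Num.min r t); first by rewrite lt_min r0.
move=> y yfg; rewrite big_cons; split.
  by apply: gsB; apply: weak_nbhd_catr yfg; rewrite ge_min lexx orbT.
by apply: fsC; apply: weak_nbhd_catl yfg; rewrite ge_min lexx.
Qed.

Lemma weak_nbhd_open (a : X) fs (r : R) :
  open (weak_nbhd setT a fs r : set (weak X)).
Proof.
have -> : (weak_nbhd setT a fs r : set (weak X)) =
    \big[setI/setT]_(f <- fs) [set y : weak X | nm (f y - f a) < r].
  rewrite -bigcap_seq; apply/seteqP; split=> y.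
    by move=> [_ yf] f /= /yf.
  by move=> yf; split=> // f /yf.
apply: big_ind => [||f _]; [exact: openT|exact: openI|].
have [r0|r0] := leP r 0.
  rewrite (_ : mkset _ = set0); first exact: open0.
  by rewrite -subset0 => y /=; rewrite ltNge (le_trans r0)// nm_ge0.
have [e e0 er] := real_part_surj (k := k) _ (ltW r0).
have egt0 : 0 < e by rewrite -ltr_real_part// real_part0 er.
pose B : set (weak X) := [set y | nm (f y - f a) < r].
have Bsub : (sup_subbase (fun f : dual X =>
      Topological.on (initial_topology (f : X -> K^o)))) B.
  exists f => //; exists (ball (f a : K^o) e); first exact: ball_open.
  apply/seteqP; split=> y; rewrite /= -ball_normE /ball_/= nm_lt// nmB er //.
exists [set B]; last by rewrite bigcup_set1.
move=> _ ->; exists [fset B]%fset.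
  by move=> C; rewrite !inE => /eqP ->; exact/mem_set.
by rewrite bigcap_fset big_seq_fset1.
Qed.

(** The pi-base consists of the nonempty relative interiors of the sets [S i], which may fail to be
    weakly open themselves. The neighbourhood of [b] makes the interior nonempty, and [b] may differ
    from [a]: this is what separates a pi-base from a base. *)
Lemma pi_base_criterion A (I : countType) (S : I -> set X) :
  (forall a fs (r : R), A a -> 0 < r -> exists i b gs, exists2 s : R, 0 < s &
     [/\ A b, weak_nbhd A b gs s `<=` S i & S i `&` A `<=` weak_nbhd A a fs r]) ->
  has_countable_pi_base (set_type (A : set (weak X))).
Proof.
move=> SP; pose T := set_type (A : set (weak X)).
pose U i : set T := (set_val @^-1` (S i : set (weak X)))°.
exists [set V | V !=set0 /\ exists i, V = U i].
  apply: (@sub_countable _ _ _ (range U)).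
    by apply: subset_card_le => V [V0 [i VE]]; exists i => //; rewrite VE.
  by apply: sub_countable (card_image_le U setT) _; exact: countableP.
split=> [V [V0 [i VE]]|V [W oO <-] [a Oa]].
  by split=> //; rewrite VE; exact: open_interior.
have [fs [r r0 fsO]] := open_weak_nbhd _ _ oO Oa.
have [i [b [gs [s s0 [Ab gsS SA]]]]] := SP _ fs _ (set_valP a) r0.
exists (U i).
  split; last by exists i.
  exists (SigSub (mem_set Ab) : T).
  exists (set_val @^-1` (weak_nbhd setT b gs s : set (weak X))).
    split; first by exists (weak_nbhd setT b gs s) => //; exact: weak_nbhd_open.
    by split=> // f _; rewrite /= subrr nm0.
  by move=> y [_ yb]; apply: gsS; split=> //; exact: set_valP.
move=> y /interior_subset Sy; apply: fsO.
by have [] := SA (set_val y) (conj Sy (set_valP y)).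
Qed.

End WeakNbhd.

(** * Coordinate functionals of a Schauder basis *)

Lemma expr_half_lt (R : realType) (C e : R) : 0 < e ->
  exists n : nat, C / 2 ^+ n < e.
Proof.
move=> e0; exists (Num.truncn (C / e)).+1.
have := truncnS_gt (C / e); set n := _.+1.
rewrite ltr_pdivrMr// ltr_pdivrMr ?exprn_gt0// => Ce.
apply: lt_le_trans Ce _; rewrite mulrC ler_pM2l// -natrX ler_nat ltnW//.
exact: ltn_expl.
Qed.

Section Banach.
Context {R : realType} {k : scalar_kind}.
Local Notation K := (scalar_field R k).

Lemma nm_lim_le (V : normedModType K) (u : nat -> V) (l v : V) (B : R) N :
  u @ \oo --> l -> (forall n, (N <= n)%N -> nm (u n - v) <= B) ->
  nm (l - v) <= B.
Proof.
move=> /nm_cvgP ul uB; apply/ler_addgt0Pr => e e0.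
have [M MP] := ul _ e0; pose n := maxn N M.
have := MP n (leq_maxr _ _); have := uB n (leq_maxl _ _).
by have := ler_nmD_dist (u n) l v; rewrite (nmB l (u n)); lra.
Qed.

(* The library's Baire theorem covers real scalars only. *)
Lemma nm_baire (V : completeNormedModType K) (F : nat -> set V) :
  (forall x, exists m, F m x) ->
  exists m x, exists2 r : R, 0 < r & forall y, nm (y - x) <= r ->
    forall d, 0 < d -> exists2 z, F m z & nm (y - z) < d.
Proof.
move=> Fcov; apply: contrapT => noball.
(* If no closed ball lies in the closure of any [F m], each ball contains another of at most half
   the radius that misses [F n]. Positivity of the radius is a premise inside the existential so
   that [choice] gives a total function, with [(0, 0)] as junk value. *)
have step (nxr : nat * (V * R)) : exists x'r' : V * R, 0 < nxr.2.2 ->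
    [/\ 0 < x'r'.2, x'r'.2 <= nxr.2.2 / 2,
      nm (x'r'.1 - nxr.2.1) <= nxr.2.2 / 2 &
      forall z, nm (z - x'r'.1) <= x'r'.2 -> ~ F nxr.1 z].
  case: nxr => n [x r] /=.
  have [r0|r0] := ltP 0 r; last by exists (0, 0); lra.
  apply: contrapT => nox; apply: noball; exists n, x, (r / 2); first lra.
  move=> y yx d d0; apply: contrapT => noz; apply: nox.
  exists (y, Num.min (r / 2) (d / 2)) => _ /=; split.
  - by rewrite lt_min !divr_gt0.
  - by rewrite ge_min lexx.
  - by [].
  move=> z; rewrite le_min => /andP[_ zy] Fz; apply: noz; exists z => //.
  by rewrite nmB; lra.
have [f fP] := choice step.
pose fix xr n : V * R := if n is m.+1 then f (m, xr m) else (0, 1).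
have r_gt0 n : 0 < (xr n).2.
  by elim: n => //= n /(fP (n, _))[].
have xrP n := fP (n, xr n) (r_gt0 n).
have r_le n : (xr n).2 <= 1 / 2 ^+ n.
  elim: n => [|n IH]; first by rewrite expr0 divr1.
  have [_ + _ _] := xrP n => /le_trans; apply.
  by rewrite exprS invfM mulrCA [leRHS]mulrC ler_pM2r.
(* Keeping the radius on the left makes the estimate telescope; it gives the Cauchy property and
   puts the limit in every ball. *)
have nested n l : (n <= l)%N -> nm ((xr l).1 - (xr n).1) + (xr l).2 <= (xr n).2.
  move=> /subnK <-; elim: (l - n)%N => [|i IH]; first by rewrite subrr nm0 add0r.
  have [_ r2 x2 _] := xrP (i + n)%N.
  have := ler_nmD_dist (xr (i + n)%N).1 (xr (i + n).+1).1 (xr n).1.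
  by rewrite addSn /= in r2 x2 *; lra.
have [e e0|l xl] := nm_complete _ (fun n => (xr n).1).
  have [N Ne] := expr_half_lt _ 1 _ e0; exists N => n /nested.
  by have := r_gt0 n; have := r_le N; lra.
have [m Fm] := Fcov l.
(* Ball [m.+1] was chosen to miss [F m], yet it contains the limit [l]. *)
have [_ _ _ /(_ l)] := xrP m; apply => //.
apply: (nm_lim_le _ _ _ _ _ m.+1 xl) => n /nested.
by have := r_gt0 n; move=> /=; lra.
Qed.
End Banach.

Section Basis.
Context {R : realType} {k : scalar_kind}.
Local Notation K := (scalar_field R k).
Context {X : completeNormedModType K} {e : nat -> X}.
Hypothesis he : schauder_basis e.

Local Notation expansion a := (series (fun j => (a : nat -> K) j *: e j)).

Definition basis_coord (x : X) : nat -> K := projT1 (cid (he x)).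

Lemma basis_coordP x : expansion (basis_coord x) @ \oo --> x.
Proof. by rewrite /basis_coord; case: cid => a []. Qed.

Lemma basis_coord_uniq a x : expansion a @ \oo --> x -> basis_coord x = a.
Proof. by rewrite /basis_coord; case: cid => b [? bP] /bP. Qed.

Lemma basis_coord_linear t x y j :
  basis_coord (t *: x + y) j = t * basis_coord x j + basis_coord y j.
Proof.
rewrite (@basis_coord_uniq (fun j => t * basis_coord x j + basis_coord y j))//.
rewrite (_ : series _ =
  (fun n => t *: expansion (basis_coord x) n + expansion (basis_coord y) n)).
  by apply: cvgD; [apply: cvgZ; [exact: cvg_cst|]|]; exact: basis_coordP.
apply/funext => n; rewrite /series /= scaler_sumr -big_split.
by apply: eq_bigr => i _; rewrite scalerDl scalerA.
Qed.

Lemma basis_coordB x y j : basis_coord (x - y) j = basis_coord x j - basis_coord y j.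
Proof. by rewrite addrC -scaleN1r basis_coord_linear mulN1r addrC. Qed.

Definition basis_proj n (x : X) : X := expansion (basis_coord x) n.

Lemma basis_proj_linear n t x y :
  basis_proj n (t *: x + y) = t *: basis_proj n x + basis_proj n y.
Proof.
rewrite /basis_proj /series /= scaler_sumr -big_split.
by apply: eq_bigr => i _; rewrite basis_coord_linear scalerDl scalerA.
Qed.

Lemma basis_projD n x y : basis_proj n (x + y) = basis_proj n x + basis_proj n y.
Proof. by rewrite -[x in LHS]scale1r basis_proj_linear scale1r. Qed.

Lemma basis_proj0 n : basis_proj n 0 = 0.
Proof.
by have := basis_proj_linear n (-1) 0 0; rewrite scaler0 addr0 scaleN1r addNr.
Qed.

Lemma basis_projZ n t x : basis_proj n (t *: x) = t *: basis_proj n x.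
Proof. by rewrite -[t *: x]addr0 basis_proj_linear basis_proj0 addr0. Qed.

Lemma basis_projB n x y : basis_proj n (x - y) = basis_proj n x - basis_proj n y.
Proof.
by rewrite addrC -scaleN1r basis_proj_linear scaleN1r addrC.
Qed.

Lemma expansionS a n : expansion a n.+1 = expansion a n + a n *: e n.
Proof. by rewrite /series /= big_nat_recr. Qed.

(** If [e j] vanished, changing the coordinate [j] of 0 would give 0 a second expansion. *)
Lemma basis_nm_gt0 j : 0 < nm (e j).
Proof.
rewrite nm_gt0; apply/eqP => ej0.
pose b i := basis_coord 0 i + (i == j)%:R.
suff /(congr1 (@^~ j)) : basis_coord 0 = b.
  by rewrite /b eqxx => /eqP; rewrite -subr_eq0 opprD addNKr oppr_eq0 oner_eq0.
apply: basis_coord_uniq.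
rewrite (_ : series _ = expansion (basis_coord 0)); first exact: basis_coordP.
apply/funext => n; apply: eq_bigr => i _; rewrite /b.
by have [->|_] := eqVneq i j; rewrite ?addr0// ej0 !scaler0.
Qed.

Lemma nm_basis_coord_le x j :
  nm (basis_coord x j) * nm (e j) <= nm (basis_proj j.+1 x) + nm (basis_proj j x).
Proof.
rewrite -nmZ; have -> : basis_coord x j *: e j = basis_proj j.+1 x - basis_proj j x.
  by rewrite /basis_proj expansionS addrC addKr.
by rewrite (le_trans (ler_nmD _ _))// nmN.
Qed.

(** The bound is a natural number so that the corresponding sets form a countable cover of [X],
    ready for [nm_baire]. *)
Lemma basis_proj_bounded x : exists m : nat, forall n, nm (basis_proj n x) <= m%:R.
Proof.
have /nm_cvgP/(_ 1 ltr01)[N NP] := basis_coordP x.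
pose B := nm x + 1 + \sum_(i < N) nm (basis_proj i x).
exists (Num.truncn B).+1 => n; apply: le_trans (ltW (truncnS_gt _)).
have s0 (P : pred 'I_N) : 0 <= \sum_(i < N | P i) nm (basis_proj i x).
  by apply: sumr_ge0 => i _; exact: nm_ge0.
rewrite /B; have [nN|/NP nN] := ltnP n N.
  rewrite (bigD1 (Ordinal nN))//=.
  by have := s0 (fun i => i != Ordinal nN); have := nm_ge0 x; lra.
have := s0 xpredT; have := ler_nmD_dist x (basis_proj n x) 0.
by rewrite !subr0; rewrite /basis_proj in nN *; lra.
Qed.

(** Each term of an expansion is a difference of consecutive projections, so the Cauchy property
    passes to the coordinates. This argument is available before the projections are known to be
    continuous. *)
Lemma basis_coord_limit (w : nat -> X) :
  (forall n (d : R), 0 < d -> exists N, forall l, (N <= l)%N ->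
     nm (basis_proj n (w l - w N)) < d) ->
  exists b : nat -> K, forall n (d : R), 0 < d -> exists N, forall l,
    (N <= l)%N -> nm (basis_proj n (w l) - expansion b n) < d.
Proof.
move=> wC.
have cC j : exists b : K, forall d : R, 0 < d ->
    exists N, forall n, (N <= n)%N -> nm (basis_coord (w n) j - b) < d.
  apply: nm_scalar_complete => d d0.
  (* Four errors arise: two projections, each compared through an intermediate index. *)
  have t0 : 0 < d * nm (e j) / 4 by rewrite !mulr_gt0// basis_nm_gt0.
  have [N NP] := wC j _ t0; have [M MP] := wC j.+1 _ t0.
  exists (maxn N M) => n nNM.
  have : nm (basis_coord (w n - w (maxn N M)) j) * nm (e j) < d * nm (e j).
    apply: le_lt_trans (nm_basis_coord_le _ _) _.
    have := NP _ (leq_trans (leq_maxl _ _) nNM).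
    have := MP _ (leq_trans (leq_maxr _ _) nNM).
    have := NP _ (leq_maxl N M); have := MP _ (leq_maxr N M).
    have := ler_nmD_dist (basis_proj j (w N)) (basis_proj j (w n))
      (basis_proj j (w (maxn N M))).
    have := ler_nmD_dist (basis_proj j.+1 (w M)) (basis_proj j.+1 (w n))
      (basis_proj j.+1 (w (maxn N M))).
    rewrite !basis_projB (nmB (basis_proj j (w N))) (nmB (basis_proj j.+1 (w M))).
    lra.
  rewrite ltr_pM2r ?basis_nm_gt0//.
  by rewrite basis_coordB.
have [b bP] := choice cC; exists b; elim=> [|n IH] d d0.
  by exists 0%N => l _; rewrite /basis_proj /series /= !big_nil subrr nm0.
have en := basis_nm_gt0 n.
have [N NP] : exists N, forall l, (N <= l)%N ->
    nm (basis_proj n (w l) - expansion b n) < d / 2 by apply: IH; lra.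
have [M MP] := bP n (d / 2 / nm (e n)) (divr_gt0 (divr_gt0 d0 (ltr0Sn _ _)) en).
exists (maxn N M) => l; rewrite geq_max => /andP[/NP wN /MP].
rewrite ltr_pdivlMr// -nmZ => wM.
rewrite /basis_proj !expansionS -/(basis_proj n (w l)) opprD addrACA -scalerBl.
by apply: le_lt_trans (ler_nmD _ _) _; lra.
Qed.

(* Completeness of [X] for the norm [sup_n |basis_proj n x|]. *)
Lemma basis_proj_uniform_limit (w : nat -> X) (x : X) (B : nat -> R) :
  w @ \oo --> x ->
  (forall m l n, (m <= l)%N -> nm (basis_proj n (w l - w m)) <= B m) ->
  (forall d, 0 < d -> exists N, forall m, (N <= m)%N -> B m < d) ->
  forall n m, nm (basis_proj n (x - w m)) <= B m.
Proof.
move=> wx wB B0.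
have [n d d0|b bP] := basis_coord_limit w.
  have [N NP] := B0 d d0; exists N => l Nl.
  exact: le_lt_trans (wB _ _ _ Nl) (NP _ _).
have bB n m : nm (expansion b n - basis_proj n (w m)) <= B m.
  apply/ler_addgt0Pr => d d0; have [N NP] := bP n d d0.
  have := wB m _ n (leq_maxr N m); have := NP _ (leq_maxl N m).
  have := ler_nmD_dist (basis_proj n (w (maxn N m))) (expansion b n)
    (basis_proj n (w m)).
  by rewrite basis_projB (nmB _ (expansion b n)); lra.
suff xb : basis_coord x = b by move=> n m; rewrite basis_projB {1}/basis_proj xb.
apply: basis_coord_uniq; apply/nm_cvgP => d d0.
have d4 : 0 < d / 4 by lra.
have [N NP] := B0 _ d4; have /nm_cvgP/(_ _ d4)[M MP] := wx.
(* Exchange of limits: this [m] works for all [n] at once, after which [n] is taken large for the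
   single vector [w m]. *)
pose m := maxn N M.
have /nm_cvgP/(_ _ d4)[L LP] := basis_coordP (w m).
exists L => n /LP; rewrite -/(basis_proj n (w m)).
have := NP _ (leq_maxl N M); have := MP _ (leq_maxr N M); have := bB n m.
have := ler_nmD_dist (basis_proj n (w m)) (expansion b n) x.
have := ler_nmD_dist (w m) (basis_proj n (w m)) x.
by rewrite -/m; lra.
Qed.

(** By Baire, the vectors with all projections bounded by some [m] are dense in a ball of radius [r]
    around some [x0]. Differences of such vectors approximate every vector of norm [r] with
    projections at most [2 * m], and scaling gives the constant [2 * m / r]. *)
Lemma basis_proj_approx : exists2 M : R, 0 <= M & forall y (d : R), 0 < d ->
  exists2 z, nm (y - z) < d & forall n, nm (basis_proj n z) <= M * nm y.
Proof.
have [m [x0 [r r0 xr]]] := nm_baire X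
  (fun m => [set x | forall n, nm (basis_proj n x) <= m%:R]) basis_proj_bounded.
exists (2 * m%:R / r); first by rewrite divr_ge0 ?mulr_ge0// ltW.
move=> y d d0; have [->|y0] := eqVneq y 0.
  by exists 0 => [|n]; rewrite ?subr0 ?basis_proj0 nm0 ?mulr0.
have ny : 0 < nm y by rewrite nm_gt0.
have [a ar] : exists a : K, nm a = r / nm y.
  by apply: nm_surj; rewrite divr_ge0// ltW.
have na : 0 < nm a by rewrite ar divr_gt0.
have a0 : a != 0 by rewrite -nm_gt0.
have aV : nm (a^-1) * nm a = 1.
  by rewrite -nmM mulVf// /nm normr1 real_part1.
have {}aV : nm (a^-1) = (nm a)^-1.
  by apply: (mulIf (lt0r_neq0 na)); rewrite aV mulVf// lt0r_neq0.
have ad : 0 < nm a * d / 2 by rewrite divr_gt0// mulr_gt0.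
have [|z1 z1m z1y] := xr (x0 + a *: y) _ _ ad.
  by rewrite addrC addKr nmZ ar divfK// lt0r_neq0.
have [|z2 z2m z2x] := xr x0 _ _ ad; first by rewrite subrr nm0 ltW.
exists (a^-1 *: (z1 - z2)) => [|n].
  rewrite -[y in y - _](scalerK a0) -scalerBr nmZ aV mulrC ltr_pdivrMr//.
  rewrite (_ : _ - _ = (x0 + a *: y - z1) - (x0 - z2)); last first.
    by rewrite !opprB [RHS]addrC -[x0 + _ - _]addrA [RHS]addrA subrK addrCA.
  by have := ler_nmD (x0 + a *: y - z1) (- (x0 - z2)); rewrite nmN; lra.
rewrite basis_projZ nmZ aV ar invfM invrK basis_projB.
have := ler_nmD (basis_proj n z1) (- basis_proj n z2); rewrite nmN.
have := z1m n; have := z2m n => /= z2n z1n z12.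
rewrite (_ : _ * nm y = r^-1 * nm y * (2 * m%:R)); last by ring.
by rewrite ler_pM2l ?mulr_gt0 ?invr_gt0//; lra.
Qed.

(* The argument of the open mapping theorem: correct [x] by successive
   approximants whose projections decay geometrically. *)
Lemma basis_constant :
  exists2 C : R, 0 <= C & forall x n, nm (basis_proj n x) <= C * nm x.
Proof.
have [M M0 MP] := basis_proj_approx; exists (2 * M); first by rewrite mulr_ge0.
move=> x n; have [->|x0] := eqVneq x 0; first by rewrite basis_proj0 nm0 mulr0.
set a := nm x; have a0 : 0 < a by rewrite /a nm_gt0.
have p2 i : 0 < (2 : R) ^+ i by rewrite exprn_gt0.
(* At stage [i] the remainder is approximated up to [a / 2 ^+ i.+1]; [rho i] below is what remains
   after [i] corrections. *)
have /choice[g gP] (yi : X * nat) : exists z,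
    nm (yi.1 - z) < a / 2 ^+ yi.2.+1 /\
    forall n, nm (basis_proj n z) <= M * nm yi.1.
  have [|z] := MP yi.1 (a / 2 ^+ yi.2.+1); first by rewrite divr_gt0.
  by exists z.
pose fix rho i := if i is j.+1 then rho j - g (rho j, j) else x.
have rhoS i : rho i.+1 = rho i - g (rho i, i) by [].
have rho_le i : nm (rho i) <= a / 2 ^+ i.
  case: i => [|i] /=; first by rewrite expr0 divr1.
  by have [/ltW] := gP (rho i, i).
have half i : a / 2 ^+ i = 2 * (a / 2 ^+ i.+1).
  by rewrite exprS; field; rewrite lt0r_neq0.
(* The subtracted term lets the geometric series be summed by induction on [l]. *)
have wB m l j : (m <= l)%N -> nm (basis_proj j ((x - rho l) - (x - rho m))) <=
    2 * M * (a / 2 ^+ m) - 2 * M * (a / 2 ^+ l).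
  move=> /subnK <-; elim: (l - m)%N => [|i IH].
    by rewrite add0n !subrr basis_proj0 nm0.
  have [_ /(_ j) /= gM] := gP (rho (i + m)%N, (i + m)%N).
  have rM := ler_wpM2l M0 (rho_le (i + m)%N).
  rewrite (_ : _ - _ = ((x - rho (i + m)%N) - (x - rho m)) +
    g (rho (i + m)%N, (i + m)%N)); last first.
    by rewrite [- (_ - g _)]opprB [g _ - _]addrC addrA [LHS]addrAC.
  have E : M * (a / 2 ^+ (i + m)) = 2 * (M * (a / 2 ^+ (i + m).+1)).
    by rewrite half mulrCA.
  rewrite basis_projD addSn; apply: le_trans (ler_nmD _ _) _; lra.
(* Index 0 is used because [x - rho 0 = 0], so that the uniform bound there reads [2 * M * a]. *)
have := basis_proj_uniform_limit (fun i => x - rho i) x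
  (fun i => 2 * M * (a / 2 ^+ i)) _ _ _ n 0%N.
have smallN d : 0 < d -> exists N, forall m, (N <= m)%N -> a / 2 ^+ m < d.
  move=> d0; have [N NP] := expr_half_lt _ a _ d0; exists N => m Nm.
  by apply: le_lt_trans NP; rewrite ler_pM2l// lef_pV2 ?posrE// ler_eXn2l ?ltr1n.
rewrite /= subrr subr0 expr0 divr1; apply.
- apply/nm_cvgP => d /smallN[N NP]; exists N => m /NP; apply: le_lt_trans.
  by rewrite addrAC subrr sub0r nmN.
- move=> m l j ml; apply: le_trans (wB _ _ _ ml) _.
  by rewrite gerBl mulr_ge0 ?mulr_ge0 ?invr_ge0 ?[_ <= a]ltW ?[_ <= 2 ^+ _]ltW.
(* The summand 1 allows division even when [M = 0]. *)
- move=> d d0; have M1 : 0 < 2 * M + 1 by lra.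
  have [N NP] := smallN _ (divr_gt0 d0 M1); exists N => m /NP.
  rewrite ltr_pdivlMr//.
  have : 0 < a / 2 ^+ m by rewrite divr_gt0.
  by nra.
Qed.

Lemma basis_coord_bounded j :
  exists2 C : R, 0 < C & forall x, nm (basis_coord x j) <= C * nm x.
Proof.
have [C C0 CP] := basis_constant; have ej := basis_nm_gt0 j.
exists ((2 * C + 1) / nm (e j)) => [|x]; first by rewrite divr_gt0//; lra.
rewrite mulrAC ler_pdivlMr//; apply: le_trans (nm_basis_coord_le _ _) _.
by have := CP x j; have := CP x j.+1; have := nm_ge0 x; nra.
Qed.

Lemma basis_coord_dual j : exists f : dual X, forall x, f x = basis_coord x j.
Proof.
suff cf : (fun x => basis_coord x j : K^o) \in @dual_pred _ X by exists (Dual cf).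
apply/asboolP; split=> [a x y|x]; first by rewrite basis_coord_linear.
have [C C0 CP] := basis_coord_bounded j.
apply/cvgrPdist_lt => d d0.
have [z z0 zd] : exists2 z : K, 0 <= z & real_part z = real_part d / C.
  by apply: real_part_surj; rewrite divr_ge0 ?ltW// real_part_gt0.
have zgt0 : 0 < z by rewrite -ltr_real_part// zd real_part0 divr_gt0// real_part_gt0.
apply/nbhs_ballP; exists z => // y; rewrite -ball_normE /ball_/= !nm_lt//.
rewrite zd ltr_pdivlMr// => xy.
by have := CP (x - y); rewrite basis_coordB mulrC => /le_lt_trans; apply.
Qed.

End Basis.

(** * Small weakly open sets *)

Section PointOfContinuity.
Context {R : realType} {k : scalar_kind}.
Local Notation K := (scalar_field R k).

(** Dividing [d] by one plus the sum of the first [N] norms gives a threshold that serves all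
    shorter sums too, hence all projections up to [N] simultaneously. *)
Lemma small_coef_sum (V : normedModType K) (v : nat -> V) N (d : R) : 0 < d ->
  exists2 s : R, 0 < s & forall (a : nat -> K) n, (n <= N)%N ->
    (forall j, (j < N)%N -> nm (a j) < s) ->
    nm (\sum_(0 <= j < n) a j *: v j) < d.
Proof.
move=> d0; pose M := 1 + \sum_(0 <= j < N) nm (v j).
have S0 m n : 0 <= \sum_(m <= j < n) nm (v j).
  by apply: sumr_ge0 => j _; exact: nm_ge0.
have M0 : 0 < M by have := S0 0%N N; rewrite /M; lra.
exists (d / M) => [|a n nN aN]; first by rewrite divr_gt0.
apply: le_lt_trans (ler_nm_sum _ _ _) _.
apply: (@le_lt_trans _ _ (\sum_(0 <= j < n) (d / M) * nm (v j))).
  apply: ler_sum_nat => j /andP[_ jn]; rewrite nmZ ler_wpM2r ?nm_ge0// ltW//.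
  by rewrite aN// (leq_trans jn).
rewrite -mulr_sumr -[ltRHS](@divfK _ M) ?lt0r_neq0// ltr_pM2l ?divr_gt0//.
by rewrite /M (@big_cat_nat _ _ _ n 0 N)//=; have := S0 n N; lra.
Qed.

Context {X : completeNormedModType K} {e : nat -> X}.
Hypothesis he : schauder_basis e.
Local Notation basis_proj := (basis_proj he).
Local Notation basis_coord := (basis_coord he).

Lemma basis_projE n x : basis_proj n x = \sum_(0 <= j < n) basis_coord x j *: e j.
Proof. by []. Qed.

(** A gliding hump argument: the negated hypothesis is iterated, each new point agreeing with the
    previous one, up to a summable error, on the block where the previous one is concentrated. *)
Lemma boundedly_complete_no_separation (V : set X) (B r : R) :
  boundedly_complete e -> (forall x, V x -> nm x <= B) -> V !=set0 -> 0 < r ->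
  ~ (forall a N d, V a -> 0 < d -> exists y,
       [/\ V y, forall n, (n <= N)%N -> nm (basis_proj n (y - a)) < d &
         r <= nm (y - a)]).
Proof.
move=> bc VB [a0 Va0] r0 sep.
(* Two consecutive points will each lie within [3 * h] of one vector, and [6 * h < r] contradicts
   their separation. *)
pose h := r / 16; have h0 : 0 < h by rewrite /h; lra.
have p2 i : 0 < (2 : R) ^+ i by rewrite exprn_gt0.
(* A state is a point with an index whose projection nearly recovers it; for points outside [V] the
   value is junk. *)
have /choice[f fP] (iaN : nat * (X * nat)) : exists bM : X * nat,
    V iaN.2.1 -> [/\ V bM.1, (iaN.2.2 < bM.2)%N,
      nm (basis_proj bM.2 bM.1 - bM.1) < h,
      forall n, (n <= iaN.2.2)%N ->
        nm (basis_proj n (bM.1 - iaN.2.1)) < h / 2 ^+ iaN.1.+1 &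
      r <= nm (bM.1 - iaN.2.1)].
  case: iaN => i [a N] /=; have [Va|nVa] := pselect (V a); last by exists (a, N).
  have [//||y [Vy ya ry]] := sep a N (h / 2 ^+ i.+1); first by rewrite divr_gt0.
  have /nm_cvgP/(_ h h0)[M MP] := basis_coordP he y.
  exists (y, maxn N.+1 M) => _ /=; split=> //; first exact: leq_maxl.
  by apply: MP; exact: leq_maxr.
pose fix s i := if i is j.+1 then f (j, s j) else (a0, 0%N).
have Vs i : V (s i).1 by elim: i => //= i /(fP (i, _))[].
have sP i := fP (i, s i) (Vs i).
have sN m l : (m <= l)%N -> ((s m).2 + (l - m) <= (s l).2)%N.
  elim: l => [|l IH]; first by rewrite leqn0 => /eqP ->; rewrite addn0.
  rewrite leq_eqVlt => /orP[/eqP ->|]; first by rewrite subnn addn0.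
  rewrite ltnS => ml; rewrite subSn// addnS.
  by have [_ + _ _ _] := sP l; apply: leq_ltn_trans; exact: IH.
have half i : h / 2 ^+ i = 2 * (h / 2 ^+ i.+1).
  by rewrite exprS; field; rewrite lt0r_neq0.
(* The later moves add up to a telescoping geometric sum, since the block indices increase and [n]
   stays below all of them. *)
have tail m l n : (m <= l)%N -> (n <= (s m).2)%N ->
    nm (basis_proj n ((s l).1 - (s m).1)) <= h / 2 ^+ m - h / 2 ^+ l.
  elim: l => [|l IH].
    by rewrite leqn0 => /eqP -> _; rewrite !subrr basis_proj0 nm0.
  rewrite leq_eqVlt => /orP[/eqP -> _|]; first by rewrite !subrr basis_proj0 nm0.
  rewrite ltnS => ml nm_; have := IH ml nm_.
  have [_ _ _ /(_ n) + _] := sP l => /=.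
  have nsl : (n <= (s l).2)%N.
    by apply: leq_trans nm_ (leq_trans (leq_addr _ _) (sN _ _ ml)).
  move=> /(_ nsl); have := half l; rewrite !basis_projB.
  have := ler_nmD_dist (basis_proj n (s l).1) (basis_proj n (f (l, s l)).1)
    (basis_proj n (s m).1).
  by move=> /=; lra.
have h2 i : 0 < h / 2 ^+ i by rewrite divr_gt0.
have h2_le m l : (m <= l)%N -> h / 2 ^+ l <= h / 2 ^+ m.
  by move=> ml; rewrite ler_pM2l// lef_pV2 ?posrE// ler_eXn2l ?ltr1n.
have nsm n m : (n <= m)%N -> (n <= (s m).2)%N.
  move=> nm_; apply: leq_trans nm_ _.
  by have := sN 0%N m (leq0n _); rewrite add0n subn0.
have [n d d0|b bP] := basis_coord_limit he (fun i => (s i).1).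
  have [N NP] := expr_half_lt _ h _ d0; exists (maxn n N) => l Nl.
  apply: le_lt_trans (tail _ _ _ Nl (nsm _ _ (leq_maxl _ _))) _.
  have := h2_le _ _ (leq_maxr n N); by have := h2 l; lra.
have near_b m n : (n <= (s m).2)%N ->
    nm (series (fun j => b j *: e j) n - basis_proj n (s m).1) <= h.
  move=> nm_; apply/ler_addgt0Pr => d d0; have [N NP] := bP n d d0.
  have := NP _ (leq_maxl N m); have := tail _ _ _ (leq_maxr N m) nm_.
  have := ler_nmD_dist (basis_proj n (s (maxn N m)).1)
    (series (fun j => b j *: e j) n) (basis_proj n (s m).1).
  have := h2 (maxn N m); have := h2_le 0%N m (leq0n _); rewrite expr0 divr1.
  rewrite basis_projB (nmB (series (fun j => b j *: e j) n)
    (basis_proj n (s (maxn N m)).1)).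
  by lra.
have [C C0 CP] := basis_constant he.
(* Partial sum [n] is within [h] of the projection of a point of [V], which the basis constant
   bounds by [C * B]. *)
have /bc/cvg_ex[x] : bounded_fun (series (fun j => b j *: e j)).
  have [z z0 zB] : exists2 z : K, 0 <= z & real_part z = C * B + h.
    apply: real_part_surj; rewrite addr_ge0 ?(ltW h0)// mulr_ge0//.
    exact: le_trans (nm_ge0 _) (VB _ Va0).
  exists z; split; first exact: ger0_real.
  move=> M zM n _; apply: le_trans (ltW zM).
  rewrite -real_part_le// zB -/(nm _).
  have := near_b _ _ (nsm _ _ (leqnn n)); have := CP (s n).1 n.
  have := ler_wpM2l C0 (VB _ (Vs n)).
  have := ler_nmD_dist (basis_proj n (s n).1) (series (fun j => b j *: e j) n) 0.
  by rewrite !subr0; lra.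
move=> /nm_cvgP/(_ h h0)[N NP].
(* The three errors: the point to its projection, that projection to the partial sum of [b], and the
   partial sum to [x]. *)
have close i : (N <= i)%N -> nm ((s i.+1).1 - x) < 3 * h.
  move=> Ni; have [_ sNi + _ _] := sP i; rewrite -/(s i.+1) => s1.
  have := near_b i.+1 _ (leqnn _).
  have := NP (s i.+1).2 (leq_trans Ni (ltnW (nsm _ _ (leqnn i.+1)))).
  have := ler_nmD_dist (basis_proj (s i.+1).2 (s i.+1).1) (s i.+1).1 x.
  have := ler_nmD_dist (series (fun j => b j *: e j) (s i.+1).2)
    (basis_proj (s i.+1).2 (s i.+1).1) x.
  move: s1; rewrite (nmB (s i.+1).1 (basis_proj _ _)) 
    (nmB (basis_proj (s i.+1).2 (s i.+1).1) (series (fun j => b j *: e j) _)).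
  by lra.
have [_ _ _ _] := sP N.+1; rewrite -/(s N.+2) => far.
have := close N (leqnn _); have := close N.+1 (leqnSn _).
have := ler_nmD_dist x (s N.+2).1 (s N.+1).1; rewrite (nmB x).
by move: far; rewrite /h /=; lra.
Qed.

(** If this fails, every weak neighbourhood of [a] inside [V] has a point at distance at least [r]
    from [a]. Neighbourhoods that control the first [N] coordinates then produce the separation
    excluded above. *)
Lemma weakly_open_small (A V : set X) (B r : R) :
  boundedly_complete e -> (forall x, A x -> nm x <= B) ->
  V `<=` A -> V !=set0 -> weak_open A V -> 0 < r ->
  exists2 a, V a & exists fs, exists2 s : R, 0 < s &
    weak_nbhd A a fs s `<=` [set y | V y /\ nm (y - a) < r].
Proof.
move=> bc AB VA V0 oV r0; apply: contrapT => nosmall.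
have := boundedly_complete_no_separation V B r bc (fun x Vx => AB _ (VA _ Vx)) V0 r0.
apply=> a N d Va d0; apply: contrapT => noy; apply: nosmall; exists a => //.
have [fs [s s0 fsV]] := oV a Va.
have [t t0 tP] := small_coef_sum X e N _ d0.
have /choice[f fP] := basis_coord_dual he.
exists (fs ++ [seq f j | j <- iota 0 N]), (Num.min s t); first by rewrite lt_min s0.
move=> y ya; have Vy : V y.
  by apply: fsV; apply: weak_nbhd_catl ya; rewrite ge_min lexx.
split=> //; rewrite ltNge; apply/negP => ry; apply: noy; exists y; split=> // n nN.
rewrite basis_projE; apply: tP => // j jN.
have [_ /(_ (f j))] : weak_nbhd A a [seq f j | j <- iota 0 N] t y.
  by apply: weak_nbhd_catr ya; rewrite ge_min lexx orbT.
by rewrite !fP basis_coordB; apply; apply/mapP; exists j => //; rewrite mem_iota.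
Qed.

End PointOfContinuity.

(** * Countable pi-bases *)

Section PiBases.
Context {R : realType} {k : scalar_kind}.
Local Notation K := (scalar_field R k).

(** This lets one sequence of scalars supply both the centres and, through its norms, the radii of
    the countable families below. *)
Lemma dense_seq_nm (q : nat -> K) :
  (forall (z : K) (d : R), 0 < d -> exists n, nm (z - q n) < d) ->
  forall s t : R, 0 <= s -> s < t -> exists n, s < nm (q n) < t.
Proof.
move=> qP s t s0 st.
have [z zst] := nm_surj (k := k) ((s + t) / 2) ltac:(lra).
have [n] := qP z ((t - s) / 2) ltac:(lra); exists n.
have := ler_nmD_dist (q n) z 0; have := ler_nmD_dist z (q n) 0.
by rewrite !subr0 zst (nmB (q n)); lra.
Qed.

Lemma nm_dual_le (X : normedModType K) (f : dual X) (x : X) :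
  nm (f x : K) <= nm f * nm x.
Proof.
have [->|x0] := eqVneq x 0; first by rewrite dual_at0 !nm0 mulr0.
rewrite /nm -real_partM// ler_real_part//.
have nx0 : 0 < `|x| by rewrite normr_gt0.
rewrite -ler_pdivrMr// mulrC -[X in X * _]ger0_norm ?invr_ge0// -normrM -dual_scale.
set A := [set `|f y| | y in [set y : X | `|y| <= 1]].
have A0 : A !=set0 by exists `|f 0|, 0 => //=; rewrite normr0.
(* [supremum] falls back to a default value, so a least upper bound must be exhibited before [xgetI]
   applies. *)
have [y Ay] : supremums A !=set0.
  apply: scalar_supremums => //; last exact: dual_image_bounded.
  by move=> _ [z _ <-] /=.
have -> : `|f| = supremum 0 A by [].
rewrite /supremum; case: ifPn => [/eqP AE|_]; first by case: A0 => z; rewrite AE.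
have [+ _] := xgetI 0 Ay; apply; exists (`|x|^-1 *: x) => //=.
by rewrite normrZ normfV normr_id mulVf// lt0r_neq0.
Qed.

Lemma bounded_set_nm (X : normedModType K) (A : set X) : bounded_set A ->
  exists2 B : R, 0 < B & forall x, A x -> nm x <= B.
Proof.
move=> /pinfty_ex_gt0[M M0 AM]; exists (real_part M); first exact: real_part_gt0.
by move=> x Ax; apply: ler_real_part; exact: AM.
Qed.

Lemma boundedly_complete_pi_base (X : completeNormedModType K) (e : nat -> X)
  (A : set X) : schauder_basis e -> boundedly_complete e -> bounded_set A ->
  has_countable_pi_base (set_type (A : set (weak X))).
Proof.
move=> he bc /bounded_set_nm[B B0 AB].
have [q qP] := scalar_dense (R := R) (k := k).
(* A list of indices into [q] encodes a finite combination of the basis with coefficients from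
   [q]. *)
pose c (l : seq nat) : X := \sum_(0 <= j < size l) q (nth 0%N l j) *: e j.
have cP x (d : R) : 0 < d -> exists l, nm (x - c l) < d.
  move=> d0; have d2 : 0 < d / 2 by lra.
  have /nm_cvgP/(_ _ d2)[N /(_ _ (leqnn N)) xN] := basis_coordP he x.
  have [s s0 sP] := small_coef_sum X e N _ d2.
  have /choice[p pP] j := qP (basis_coord he x j) s s0.
  exists (mkseq p N).
  have := sP (fun j => basis_coord he x j - q (p j)) N (leqnn N) (fun j _ => pP j).
  have -> : \sum_(0 <= j < N) (basis_coord he x j - q (p j)) *: e j =
      series (fun j => basis_coord he x j *: e j) N - c (mkseq p N).
    rewrite /c size_mkseq -sumrB; apply: eq_big_nat => j /andP[_ jN].
    by rewrite nth_mkseq// scalerBl.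
  have := ler_nmD_dist (series (fun j => basis_coord he x j *: e j) N) x
    (c (mkseq p N)).
  by rewrite (nmB x (series (fun j => basis_coord he x j *: e j) N)); lra.
apply: (@pi_base_criterion _ _ _ _ (seq nat * nat)%type
  (fun li => [set y | nm (y - c li.1) < nm (q li.2)])) => a fs r Aa r0.
pose L := 1 + \sum_(f <- fs) nm f.
have L0 : 0 < L.
  by rewrite ltr_pwDl// sumr_ge0// => f _; exact: nm_ge0.
have fL f x : f \in fs -> nm (f x : K) <= L * nm x.
  move=> ffs; apply: le_trans (nm_dual_le _ _ _) _.
  rewrite ler_wpM2r ?nm_ge0// /L (big_rem f)//=.
  have : 0 <= \sum_(g <- rem f fs) nm g.
    by rewrite sumr_ge0// => g _; exact: nm_ge0.
  by lra.
(* The ball chosen below stays within [4 * d] of [b], which costs each functional at most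
   [4 * r / 10]; with the [r / 2] from [b] to [a] the total is below [r]. *)
pose d := r / (10 * L); have d0 : 0 < d by rewrite divr_gt0// mulr_gt0.
have Ld : L * d = r / 10 by rewrite /d; field; rewrite lt0r_neq0.
have [||b [Ab bfs] [gs [s s0 sP]]] := weakly_open_small he A
  (weak_nbhd A a fs (r / 2)) B d bc AB _ _ (weak_open_nbhd _ _ _ _) d0.
- by move=> y [].
- by exists a; split=> // f _; rewrite subrr nm0; lra.
have [l lb] := cP b d d0.
(* Above [2 * d] the ball contains the small weak neighbourhood of [b]; below [3 * d] it stays
   within [4 * d] of [b]. *)
have [i /andP[i1 i2]] := dense_seq_nm q qP (2 * d) (3 * d) ltac:(lra) ltac:(lra).
exists (l, i), b, gs, s => //; split=> // [y /sP[_ yb]|y [/= yl Ay]].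
  by have := ler_nmD_dist b y (c l); rewrite /=; lra.
split=> // f ffs; have := fL f (y - b) ffs; rewrite dualB.
have yb : nm (y - b) <= 4 * d.
  by have := ler_nmD_dist (c l) y b; rewrite (nmB (c l) b); lra.
have := ler_wpM2l (ltW L0) yb; have := bfs f ffs.
have := ler_nmD_dist (f b : K) (f y) (f a).
by lra.
Qed.

(** Each [f] is within [r / (4 * B)] in norm of a combination [h] of the [es j], so [f] and [h]
    differ by at most [r / 4] on [A]. If [h] varies by less than [r / 4], then [f] varies by less
    than [r]. *)
Lemma shrinking_weak_nbhd (X : normedModType K) (es : nat -> dual X)
    (A : set X) (B : R) a fs (r : R) :
  schauder_basis es -> 0 < B -> (forall x, A x -> nm x <= B) -> A a -> 0 < r ->
  exists N, exists2 d : R, 0 < d &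
    weak_nbhd A a [seq es j | j <- iota 0 N] d `<=` weak_nbhd A a fs r.
Proof.
move=> hes B0 AB Aa r0; elim: fs => [|f fs [N [d d0 dP]]].
  by exists 0%N, 1 => // y [].
have r4 : 0 < r / (4 * B) by rewrite divr_gt0// mulr_gt0.
have [b [/nm_cvgP/(_ _ r4)[M /(_ _ (leqnn M)) bf] _]] := hes f.
(* The roles are exchanged: the coefficients [b j] act as vectors, and the increments
   [es j y - es j a] as scalars. *)
have [t t0 tP] := small_coef_sum K^o b M (r / 4) ltac:(lra).
exists (maxn N M), (Num.min d t); first by rewrite lt_min d0.
move=> y [Ay yes]; have {}yes j : (j < maxn N M)%N ->
    nm (es j y - es j a) < Num.min d t.
  by move=> jNM; apply: yes; apply/mapP; exists j => //; rewrite mem_iota.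
have [_ yfs] : weak_nbhd A a fs r y.
  apply: dP; split=> // g /mapP[j]; rewrite mem_iota => /andP[_ jN] ->.
  apply: lt_le_trans (yes j _) _; first by rewrite leq_max jN.
  by rewrite ge_min lexx.
split=> // g; rewrite inE => /orP[/eqP ->|]; last exact: yfs.
pose h : dual X := series (fun j => b j *: es j) M.
have hE x : h x = \sum_(0 <= j < M) b j * es j x.
  rewrite /h /series /=; elim/big_ind2 : _ => // g1 z1 g2 z2 <- <- //.
have hy : nm (h y - h a : K) < r / 4.
  have -> : h y - h a = \sum_(0 <= j < M) (es j y - es j a) *: (b j : K^o).
    rewrite !hE -sumrB; apply: eq_bigr => j _.
    by rewrite -[RHS]/((es j y - es j a : K) * b j) mulrBl ![_ * b j]mulrC.
  apply: tP => // j jM; apply: lt_le_trans (yes j _) _.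
    by rewrite leq_max jM orbT.
  by rewrite ge_min lexx orbT.
have fh x : A x -> nm (f x - h x : K) <= r / 4.
  move=> Ax; have := nm_dual_le _ (h - f) x; rewrite -/(nm _) => hx.
  rewrite nmB; apply: le_trans hx _.
  rewrite (_ : r / 4 = r / (4 * B) * B); last by field; rewrite lt0r_neq0.
  by rewrite ler_pM ?nm_ge0// ?AB// ltW.
have := fh y Ay; have := fh a Aa; rewrite (nmB (f a : K)).
have := ler_nmD_dist (h y : K) (f y) (f a).
have := ler_nmD_dist (h a : K) (h y) (f a).
by lra.
Qed.

Lemma shrinking_pi_base (X : normedModType K) (e : nat -> X) (A : set X) :
  shrinking e -> bounded_set A ->
  has_countable_pi_base (set_type (A : set (weak X))).
Proof.
move=> [es _ hes] /bounded_set_nm[B B0 AB].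
have [q qP] := scalar_dense (R := R) (k := k).
apply: (@pi_base_criterion _ _ _ _ (seq nat * nat)%type
  (fun li => [set y | forall j, (j < size li.1)%N ->
     nm (es j y - q (nth 0%N li.1 j) : K) < nm (q li.2)])) => a fs r Aa r0.
have [N [d d0 dP]] := shrinking_weak_nbhd X es A B a fs r hes B0 AB Aa r0.
have d8 : 0 < d / 8 by lra.
have /choice[p pP] j := qP (es j a) _ d8.
(* With centres [d / 8] from the coordinates of [a], a radius above [d / 4] captures the [d / 8]
   neighbourhood of [a], and one below [d / 2] stays inside its [d] neighbourhood. *)
have [i /andP[i1 i2]] := dense_seq_nm q qP (d / 4) (d / 2) ltac:(lra) ltac:(lra).
exists (mkseq p N, i), a, [seq es j | j <- iota 0 N], (d / 8) => //.
split=> // [y [Ay yes] j /=|y [/= yS Ay]].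
  rewrite size_mkseq => jN; rewrite nth_mkseq//.
  have /yes : es j \in [seq es j | j <- iota 0 N].
    by apply/mapP; exists j => //; rewrite mem_iota.
  have := pP j; have := ler_nmD_dist (es j a : K) (es j y) (q (p j)).
  by lra.
apply: dP; split=> // g /mapP[j]; rewrite mem_iota => /andP[_ jN] ->.
have := yS j; rewrite size_mkseq nth_mkseq// => /(_ jN).
have := pP j; rewrite nmB; have := ler_nmD_dist (q (p j)) (es j y) (es j a).
by lra.
Qed.

End PiBases.

Theorem theorem5p3 (R : realType) (k : scalar_kind)
    (X : completeNormedModType (scalar_field R k)) (e : nat -> X)
    (he : schauder_basis e) (hsb : shrinking e \/ boundedly_complete e) :
  (forall A : set X, bounded_set A -> convex_set A ->
     has_countable_pi_base (set_type (A : set (weak X)))) /\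
  has_countable_pi_base (set_type ([set x : X | `|x| <= 1] : set (weak X))).
Proof.
have piA (A : set X) : bounded_set A ->
    has_countable_pi_base (set_type (A : set (weak X))).
  by case: hsb => [sh|bc];
    [exact: shrinking_pi_base sh|exact: boundedly_complete_pi_base].
split=> [A bA _|]; first exact: piA.
apply: piA; exists 1; split=> // M M1 x /= x1.
exact: le_trans x1 (ltW M1).
Qed.
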